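(* Let $n\in\mathbb{N}$, $a,b\in\mathbb{R}$, $c\in\mathbb{R}\setminus\{0\}$ and $L\in\mathbb{R}$. Let $$g(y_1,y_2)=c(y_1-a)^{n+1}+i(n+1)(y_2-b),\qquad h(y_1,y_2)=c(y_1-a)^{n+1}-i(n+1)(y_2-b),$$ $$f_{\infty,L}(y_1,y_2)=g(y_1,y_2)^{\frac{1+L}{2n+2}}\,h(y_1,y_2)^{\frac{1-L}{2n+2}}.$$ Then the function $f_{\infty,L}$ is a smooth solution to the Dirichlet problem $$\begin{cases}\overline{\Delta_\infty}f_{\infty,L}(q)=0, & q\in\mathbb{G}_n\setminus\{(a,b)\},\\ f_{\infty,L}(q)=0, & q=(a,b).\end{cases}$$
   Context: The Grushin-type plane $\mathbb{G}_n$ is $\mathbb{R}^2$ with coordinates $(y_1,y_2)$ and the vector fields $Y_1=\frac{\partial}{\partial y_1}$, $Y_2=c(y_1-a)^n\frac{\partial}{\partial y_2}$, which are taken to be orthonormal. For a function $f$ put $\xi_1=Y_1f+iLY_2f$, $\xi_2=Y_2f-iLY_1f$ and $\|\xi\|^2=\xi_1\overline{\xi_1}+\xi_2\overline{\xi_2}$. The operator $\overline{\Delta_\infty}$ is defined by $$\overline{\Delta_\infty}f=\big(Y_1\|\xi\|^2\big)\xi_1+\big(Y_2\|\xi\|^2\big)\xi_2.$$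
   Formalization: The powers are multivalued, so f_{∞,L} is read as any continuous branch on an open part of G_n∖{(a,b)}; branches exist near every point, and on all of G_n∖{(a,b)} if n is odd or L is an integer multiple of n+1 (otherwise monodromy prevents a global smooth f_{∞,L}). *)

(* Defs.v *)
From mathcomp Require Import all_boot all_order all_algebra.
From mathcomp Require Import all_classical all_reals all_analysis.
From mathcomp.real_closed Require Export complex.

Set Implicit Arguments.
Unset Strict Implicit.
Unset Printing Implicit Defensive.

Import Order.TTheory GRing.Theory Num.Theory.
Import numFieldNormedType.Exports.

Local Open Scope classical_set_scope.
Local Open Scope ring_scope.
Local Open Scope complex_scope.

Section Smooth.
Context {R : realType}.
Implicit Types (D : set (R * R)) (f : R * R -> R[i]).

Definition dir1 : R * R := (1, 0).
Definition dir2 : R * R := (0, 1).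

(* For a complex-valued function on R^2, continuity, derivability and
   derivatives are those of its real and imaginary parts. *)
Definition ccontinuous_at f (q : R * R) : Prop :=
  {for q, continuous (fun p => complex.Re (f p))} /\
  {for q, continuous (fun p => complex.Im (f p))}.

Definition cderivable f (q v : R * R) : Prop :=
  derivable (fun p => complex.Re (f p)) q v /\
  derivable (fun p => complex.Im (f p)) q v.

Definition cderive (v : R * R) f (q : R * R) : R[i] :=
  'D_v (fun p => complex.Re (f p)) q +i* 'D_v (fun p => complex.Im (f p)) q.

(* class C^k on D (meant for open D): all iterated partial derivatives of
   order at most k exist and are continuous at every point of D *)
Fixpoint Ck_on (k : nat) D f : Prop :=
  (forall q, D q -> ccontinuous_at f q) /\
  (if k is k'.+1 then
     [/\ forall q, D q -> cderivable f q dir1 /\ cderivable f q dir2,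
         Ck_on k' D (cderive dir1 f) &
         Ck_on k' D (cderive dir2 f)]
   else True).

Definition smooth_on D f : Prop := forall k, Ck_on k D f.

End Smooth.

Section ComplexPower.
Context {R : realType}.

Definition cis (t : R) : R[i] := cos t +i* sin t.

Definition is_arg (z : R[i]) (t : R) : Prop :=
  z = (ComplexField.Normc.normc z)%:C * cis t.

(* The set of values exp(s log z) = |z|^s e^{ist}, t an argument of z, of the
   multivalued power z^s (s real). At z = 0 every t is an argument, and the
   convention of powR makes 0 the only value, except that 0^0 = 1. *)
Definition cpow_values (z : R[i]) (s : R) : set (R[i]) :=
  [set w | exists2 t : R, is_arg z t &
     w = ((ComplexField.Normc.normc z) `^ s)%:C * cis (s * t)].

End ComplexPower.

Section Grushin.
Context {R : realType}.
Variables (n : nat) (a b c L : R).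
Implicit Types (f : R * R -> R[i]).

Definition Y1 f (q : R * R) : R[i] := cderive dir1 f q.

Definition Y2 f (q : R * R) : R[i] :=
  (c * (q.1 - a) ^+ n)%:C * cderive dir2 f q.

Definition xi1 f (q : R * R) : R[i] := Y1 f q + 'i%C * L%:C * Y2 f q.

Definition xi2 f (q : R * R) : R[i] := Y2 f q - 'i%C * L%:C * Y1 f q.

Definition xi_norm2 f (q : R * R) : R[i] :=
  xi1 f q * conjc (xi1 f q) + xi2 f q * conjc (xi2 f q).

Definition Delta_infty_bar f (q : R * R) : R[i] :=
  Y1 (xi_norm2 f) q * xi1 f q + Y2 (xi_norm2 f) q * xi2 f q.

Definition g_fun (q : R * R) : R[i] :=
  (c * (q.1 - a) ^+ n.+1)%:C + 'i%C * (n.+1%:R * (q.2 - b))%:C.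

Definition h_fun (q : R * R) : R[i] :=
  (c * (q.1 - a) ^+ n.+1)%:C - 'i%C * (n.+1%:R * (q.2 - b))%:C.

Definition f_infty_values (q : R * R) : set (R[i]) :=
  [set w | exists w1 w2,
     [/\ cpow_values (g_fun q) ((1 + L) / (2 * n + 2)%N%:R) w1,
         cpow_values (h_fun q) ((1 - L) / (2 * n + 2)%N%:R) w2 &
         w = w1 * w2]].

(* f_{oo,L} = g^{(1+L)/(2n+2)} h^{(1-L)/(2n+2)} is a multivalued expression.
   A branch of it on D takes at every point of the plane one of the values of
   the expression, and is continuous on D. In general there is none on the
   whole punctured plane: for n even, g winds once around 0 along a loop around
   (a, b), which multiplies the expression by exp(+/- 2 pi i L / (n + 1)). *)
Definition f_infty_branch (D : set (R * R)) f : Prop :=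
  (forall q, f_infty_values q (f q)) /\
  (forall q, D q -> ccontinuous_at f q).

(* The boundary value at (a, b) is also required to be attained continuously:
   for |L| > 1 one of the exponents is negative, and the value of the formula
   at (a, b) by itself is only a convention. *)
Definition smooth_dirichlet_solution (D : set (R * R)) f : Prop :=
  [/\ smooth_on D f,
      forall q, D q -> Delta_infty_bar f q = 0,
      f (a, b) = 0 &
      ccontinuous_at f (a, b)].

End Grushin.

(* Main.v *)
Require Import Defs.
From mathcomp Require Import all_boot all_order all_algebra.
From mathcomp Require Import all_classical all_reals all_analysis.
From mathcomp Require Import ring lra.
Import Order.TTheory GRing.Theory Num.Theory.
Import numFieldNormedType.Exports.
Set Implicit Arguments.
Unset Strict Implicit.
Unset Printing Implicit Defensive.
Local Open Scope classical_set_scope.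
Local Open Scope ring_scope.
Local Open Scope complex_scope.

(** Write N = n + 1, alpha = (1 + L) / (2 N) and beta = (1 - L) / (2 N). The
function is exp (alpha log g + beta log h), where h is the conjugate of g. Its
values at a point differ by factors cis (2 pi (alpha k - beta k')) with k and k'
integers, which form a countable set. So two continuous branches have locally a
constant ratio: the real and imaginary parts of the ratio are continuous and
take countably many values, and by the intermediate value theorem such a function is constant along segments
([countable_image_constant], [branch_ratio_locally_constant]). Comparing with
|g|^(alpha + beta) cis ((alpha - beta) arg g), for an explicit argument on a slit
plane, every branch F satisfies the linear system
  dF = (alpha dg / g + beta dh / h) F            ([is_cderive_branch]).

Smoothness and the equation follow from this system. Smoothness: F is continuous
and its first derivatives are F times smooth coefficients, so F is C^k for all k
by induction ([smooth_on_linear_system]). The equation: with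
s = Y1 g = c N (y1 - a)^n one has Y1 h = s, Y2 g = i s and Y2 h = - i s, whence
  xi1 = kappa s (1/g + 1/h) F,   xi2 = i kappa s (1/g - 1/h) F
with kappa = alpha (1 - L) = beta (1 + L). Hence the squared norm of xi is
4 kappa^2 s^2 |F|^2 / (g h), and what remains is a rational identity which uses
only i^2 = -1, alpha + beta = 1 / N, g + h = 2 c (y1 - a)^N and
(y1 - a) ds/dy1 = n s ([infty_laplacian_algebra]). The boundary condition:
every value of the expression has modulus |g|^(1/N), which vanishes at (a, b)
and is continuous there.

Branches are built from arguments of g. An argument continuous on a slit plane
gives one near any point. For n odd the real part of g does not change sign, so
a single slit plane contains the whole image of the punctured plane. If
L = k N with k an integer then alpha - beta = k, and cis (k t) does not depend on
the choice of the argument t. *)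

(** * Differential calculus of complex-valued functions of two real variables *)

(** Along the line through x with direction v this is the one-variable chain
rule. *)
Lemma is_derive_comp1 (R : realType) (V : normedModType R) (h : R -> R)
    (u : V -> R) (x v : V) (dh du : R) :
  is_derive (u x) 1 h dh -> is_derive x v u du ->
  is_derive x v (h \o u) (dh * du).
Proof.
move=> hh hu.
pose l (t : R) := t *: v + x.
have dl w : 'D_1 (w \o l) 0 = 'D_v w x :> R.
  rewrite /derive; set g1 := fun h => h^-1 *: _; set g2 := fun h => h^-1 *: _.
  suff -> : g1 = g2 by [].
  by apply/funext => t; rewrite /g1 /g2 /l /= addr0 scale0r add0r [_%:A]mulr1.
have hul : is_derive (0 : R) 1 (u \o l) du.
  by case: hu => du1 <-; split; [exact: (derivable1P _ _ _).1 du1|rewrite dl].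
have hhl : is_derive ((u \o l) 0) 1 h dh by rewrite /l /= scale0r add0r.
have [c1 c2] := is_derive1_comp hhl hul.
split; first exact: (derivable1P _ _ _).2 c1.
by rewrite -c2 -dl.
Qed.

Lemma scaleRE (R : realType) (x y : R) : x *: (y : R^o) = x * y.
Proof. by []. Qed.

Section ComplexDerivative.
Context {R : realType}.
Implicit Types (F G : R * R -> R[i]) (q v : R * R) (d e : R[i]).

(** Existence and value of a derivative in one predicate, so that the rules of
calculus compose without side conditions of derivability. *)
Definition is_cderive F q v d : Prop :=
  is_derive q v (fun p => complex.Re (F p)) (complex.Re d) /\
  is_derive q v (fun p => complex.Im (F p)) (complex.Im d).

Lemma is_cderive_derivable F q v d : is_cderive F q v d -> cderivable F q v.
Proof. by move=> [[? _] [? _]]. Qed.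

Lemma is_cderive_val F q v d : is_cderive F q v d -> cderive v F q = d.
Proof. by move=> [[_ h1] [_ h2]]; rewrite /cderive h1 h2; case: d {h1 h2}. Qed.

Lemma cderivableP F q v : cderivable F q v -> is_cderive F q v (cderive v F q).
Proof. by move=> [h1 h2]; split; exact: derivableP. Qed.

Lemma is_cderive_eq F q v d e : is_cderive F q v d -> d = e -> is_cderive F q v e.
Proof. by move=> ? <-. Qed.

Lemma is_cderive_near F G q v d :
  (\near q, F q = G q) -> is_cderive F q v d -> is_cderive G q v d.
Proof.
move=> FG [h1 h2]; split; [apply: near_eq_is_derive h1|apply: near_eq_is_derive h2];
  by apply: filterS FG => p ->.
Qed.

Lemma ccontinuous_near F G q :
  (\near q, F q = G q) -> ccontinuous_at F q -> ccontinuous_at G q.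
Proof.
move=> FG [h1 h2]; have FGq := nbhs_singleton FG.
split; rewrite /prop_for /continuous_at -FGq.
  by apply: cvg_trans h1; apply: near_eq_cvg; apply: filterS FG => p ->.
by apply: cvg_trans h2; apply: near_eq_cvg; apply: filterS FG => p ->.
Qed.

Lemma is_cderive_cst d q v : is_cderive (fun=> d) q v 0.
Proof. by split; exact: is_derive_cst. Qed.

Lemma complex_ReD (x y : R[i]) : complex.Re (x + y) = complex.Re x + complex.Re y.
Proof. by case: x; case: y. Qed.

Lemma complex_ImD (x y : R[i]) : complex.Im (x + y) = complex.Im x + complex.Im y.
Proof. by case: x; case: y. Qed.

Lemma complex_ReN (x : R[i]) : complex.Re (- x) = - complex.Re x.
Proof. by case: x. Qed.

Lemma complex_ImN (x : R[i]) : complex.Im (- x) = - complex.Im x.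
Proof. by case: x. Qed.

Lemma complex_ReM (x y : R[i]) : complex.Re (x * y) =
  complex.Re x * complex.Re y - complex.Im x * complex.Im y.
Proof. by case: x; case: y. Qed.

Lemma complex_ImM (x y : R[i]) : complex.Im (x * y) =
  complex.Re x * complex.Im y + complex.Im x * complex.Re y.
Proof. by case: x; case: y. Qed.

Lemma Re_funD F G : (fun p => complex.Re (F p + G p)) =
  (fun p => complex.Re (F p)) + (fun p => complex.Re (G p)).
Proof. by apply/funext => p; rewrite complex_ReD. Qed.

Lemma Im_funD F G : (fun p => complex.Im (F p + G p)) =
  (fun p => complex.Im (F p)) + (fun p => complex.Im (G p)).
Proof. by apply/funext => p; rewrite complex_ImD. Qed.

Lemma Re_funM F G : (fun p => complex.Re (F p * G p)) =
  (fun p => complex.Re (F p)) * (fun p => complex.Re (G p))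
  - (fun p => complex.Im (F p)) * (fun p => complex.Im (G p)).
Proof. by apply/funext => p; rewrite complex_ReM. Qed.

Lemma Im_funM F G : (fun p => complex.Im (F p * G p)) =
  (fun p => complex.Re (F p)) * (fun p => complex.Im (G p))
  + (fun p => complex.Im (F p)) * (fun p => complex.Re (G p)).
Proof. by apply/funext => p; rewrite complex_ImM. Qed.

Lemma Re_fun_conj F :
  (fun p => complex.Re (conjc (F p))) = (fun p => complex.Re (F p)).
Proof. by apply/funext => p; case: (F p). Qed.

Lemma Im_fun_conj F :
  (fun p => complex.Im (conjc (F p))) = - (fun p => complex.Im (F p)).
Proof. by apply/funext => p; rewrite fctE; case: (F p). Qed.

Definition sqr_modulus F : R * R -> R :=
  (fun p => complex.Re (F p)) ^+ 2 + (fun p => complex.Im (F p)) ^+ 2.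

Lemma sqr_modulusE F p :
  sqr_modulus F p = complex.Re (F p) ^+ 2 + complex.Im (F p) ^+ 2.
Proof. by []. Qed.

Lemma sqr_modulus_neq0 F p : F p != 0 -> sqr_modulus F p != 0.
Proof.
by rewrite eq_complex sqr_modulusE /= paddr_eq0 ?sqr_ge0 // !sqrf_eq0.
Qed.

Lemma complex_invE (z : R[i]) : z^-1 =
  (complex.Re z / (complex.Re z ^+ 2 + complex.Im z ^+ 2)) +i*
  (- (complex.Im z / (complex.Re z ^+ 2 + complex.Im z ^+ 2))).
Proof. by case: z. Qed.

Lemma Re_funV F : (fun p => complex.Re (F p)^-1) =
  (fun p => complex.Re (F p)) * (fun p => (sqr_modulus F p)^-1).
Proof. by apply/funext => p; rewrite complex_invE. Qed.

Lemma Im_funV F : (fun p => complex.Im (F p)^-1) =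
  - ((fun p => complex.Im (F p)) * (fun p => (sqr_modulus F p)^-1)).
Proof. by apply/funext => p; rewrite complex_invE. Qed.

Lemma is_cderiveD F G q v d e : is_cderive F q v d -> is_cderive G q v e ->
  is_cderive (fun p => F p + G p) q v (d + e).
Proof.
move=> [f1 f2] [g1 g2]; rewrite /is_cderive Re_funD Im_funD complex_ReD complex_ImD.
by split; exact: is_deriveD.
Qed.

Lemma is_cderiveM F G q v d e : is_cderive F q v d -> is_cderive G q v e ->
  is_cderive (fun p => F p * G p) q v (d * G q + F q * e).
Proof.
move=> [f1 f2] [g1 g2]; rewrite /is_cderive Re_funM Im_funM; split.
  apply: is_derive_eq (is_deriveB (is_deriveM f1 g1) (is_deriveM f2 g2)) _.
  by rewrite complex_ReD !complex_ReM !scaleRE; set x := F q; set y := G q; ring.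
apply: is_derive_eq (is_deriveD (is_deriveM f1 g2) (is_deriveM f2 g1)) _.
by rewrite complex_ImD !complex_ImM !scaleRE; set x := F q; set y := G q; ring.
Qed.

Lemma is_cderive_conj F q v d : is_cderive F q v d ->
  is_cderive (fun p => conjc (F p)) q v (conjc d).
Proof.
move=> [f1 f2]; rewrite /is_cderive Re_fun_conj Im_fun_conj.
by split; [case: (d) f1|have := is_deriveN f2; case: (d)].
Qed.

Lemma is_cderive_real (u : R * R -> R) q v (du : R) : is_derive q v u du ->
  is_cderive (fun p => (u p)%:C) q v du%:C.
Proof. by move=> hu; split => //=; exact: is_derive_cst. Qed.

Lemma is_derive_inv (V : normedModType R) (u : V -> R) (x v : V) (du : R) :
  u x != 0 -> is_derive x v u du ->
  is_derive x v (fun y => (u y)^-1) (- (u x) ^- 2 * du).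
Proof.
move=> ux [h1 h2]; split; first exact: derivableV.
by rewrite deriveV // h2.
Qed.

Lemma is_derive_sqr_modulus F q v d : is_cderive F q v d ->
  is_derive q v (sqr_modulus F)
    (2 * (complex.Re (F q) * complex.Re d + complex.Im (F q) * complex.Im d)).
Proof.
move=> [f1 f2].
apply: is_derive_eq (is_deriveD (is_deriveX 2 f1) (is_deriveX 2 f2)) _.
by rewrite !expr1 !scaleRE; set x := F q; ring.
Qed.

Lemma is_cderiveV F q v d : F q != 0 -> is_cderive F q v d ->
  is_cderive (fun p => (F p)^-1) q v (- d / (F q) ^+ 2).
Proof.
move=> Fq dF; have [f1 f2] := dF.
have m0 := sqr_modulus_neq0 Fq.
have dm := is_derive_inv m0 (is_derive_sqr_modulus dF).
have -> : - d / F q ^+ 2 = (- d) * ((F q)^-1 * (F q)^-1) by rewrite -invfM.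
rewrite /is_cderive Re_funV Im_funV; split.
  apply: is_derive_eq (is_deriveM f1 dm) _; rewrite sqr_modulusE in m0 *.
  rewrite !scaleRE !complex_ReM !complex_ImM complex_invE complex_ReN complex_ImN /=.
  by field.
apply: is_derive_eq (is_deriveN (is_deriveM f2 dm)) _; rewrite sqr_modulusE in m0 *.
rewrite !scaleRE !complex_ImM !complex_ReM complex_invE complex_ReN complex_ImN /=.
by field.
Qed.

Lemma is_derive_fst q v : is_derive q v (fun p : R * R => p.1) v.1.
Proof.
have dq : differentiable (@fst R R) q.
  by apply: (@linear_differentiable _ _ _ (@fst R R)) => p; exact: cvg_fst.
split; first exact: diff_derivable.
by rewrite deriveE // (@diff_lin _ _ _ (@fst R R)) // => p; exact: cvg_fst.
Qed.

Lemma is_derive_snd q v : is_derive q v (fun p : R * R => p.2) v.2.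
Proof.
have dq : differentiable (@snd R R) q.
  by apply: (@linear_differentiable _ _ _ (@snd R R)) => p; exact: cvg_snd.
split; first exact: diff_derivable.
by rewrite deriveE // (@diff_lin _ _ _ (@snd R R)) // => p; exact: cvg_snd.
Qed.

Lemma ccontinuousD F G q : ccontinuous_at F q -> ccontinuous_at G q ->
  ccontinuous_at (fun p => F p + G p) q.
Proof.
move=> [f1 f2] [g1 g2]; rewrite /ccontinuous_at Re_funD Im_funD.
by split; exact: continuousD.
Qed.

Lemma ccontinuousM F G q : ccontinuous_at F q -> ccontinuous_at G q ->
  ccontinuous_at (fun p => F p * G p) q.
Proof.
move=> [f1 f2] [g1 g2]; rewrite /ccontinuous_at Re_funM Im_funM; split.
  by apply: continuousB; exact: continuousM.
by apply: continuousD; exact: continuousM.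
Qed.

Lemma ccontinuous_conj F q : ccontinuous_at F q ->
  ccontinuous_at (fun p => conjc (F p)) q.
Proof.
move=> [f1 f2]; rewrite /ccontinuous_at Re_fun_conj Im_fun_conj.
by split => //; exact: continuousN.
Qed.

Lemma continuous_sqr_modulus F q : ccontinuous_at F q ->
  {for q, continuous (sqr_modulus F)}.
Proof.
by move=> [f1 f2]; rewrite /sqr_modulus !expr2; apply: continuousD; exact: continuousM.
Qed.

Lemma ccontinuousV F q : F q != 0 -> ccontinuous_at F q ->
  ccontinuous_at (fun p => (F p)^-1) q.
Proof.
move=> Fq cF; have [f1 f2] := cF.
have cV : {for q, continuous (fun p => (sqr_modulus F p)^-1)}.
  by apply: cvgV; [exact: sqr_modulus_neq0|exact: continuous_sqr_modulus].
rewrite /ccontinuous_at Re_funV Im_funV; split; first exact: continuousM.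
by apply: continuousN; exact: continuousM.
Qed.

Lemma ccontinuous_cst d q : ccontinuous_at (fun=> d) q.
Proof. by split; exact: cvg_cst. Qed.

Lemma ccontinuous_real (u : R * R -> R) q : {for q, continuous u} ->
  ccontinuous_at (fun p => (u p)%:C) q.
Proof. by move=> hu; split => //=; exact: cvg_cst. Qed.

End ComplexDerivative.

Section SmoothClosure.
Context {R : realType}.
Variable D : set (R * R).
Hypothesis Do : open D.
Implicit Types (F G : R * R -> R[i]).

(** On an open set a function and its iterated derivatives are determined near
each point by its values on the set. *)
Lemma Ck_on_ext k F G : {in D, F =1 G} -> Ck_on k D F -> Ck_on k D G.
Proof.
elim: k F G => [|k IH] F G FG.
  move=> [cF _]; split => // q Dq; apply: ccontinuous_near (cF q Dq).
  by apply: filterS (open_nbhs_nbhs (conj Do Dq)) => p /mem_set /FG.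
move=> [cF [dF F1 F2]].
have near_FG q : D q -> \near q, F q = G q.
  by move=> Dq; apply: filterS (open_nbhs_nbhs (conj Do Dq)) => p /mem_set /FG.
have step q v : D q -> cderivable F q v -> is_cderive G q v (cderive v F q).
  by move=> Dq /cderivableP; apply: is_cderive_near; exact: near_FG.
split; first by move=> q Dq; apply: ccontinuous_near (cF q Dq); exact: near_FG.
split.
- move=> q Dq; have [d1 d2] := dF q Dq.
  by split; apply: is_cderive_derivable; exact: step.
- apply: IH F1 => q; rewrite inE => Dq; have [d1 d2] := dF q Dq.
  by rewrite (is_cderive_val (step q _ Dq d1)).
- apply: IH F2 => q; rewrite inE => Dq; have [d1 d2] := dF q Dq.
  by rewrite (is_cderive_val (step q _ Dq d2)).
Qed.

Lemma Ck_on_cont k F q : Ck_on k D F -> D q -> ccontinuous_at F q.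
Proof. by case: k => [|k] [cF _] Dq; exact: cF. Qed.

Lemma Ck_onW k F : Ck_on k.+1 D F -> Ck_on k D F.
Proof.
elim: k F => [|k IH] F [cF [dF F1 F2]]; first by split.
by split; [|split; [|exact: IH F1|exact: IH F2]].
Qed.

(** The way to climb one degree: it suffices to know the derivatives at the
points of D, whatever [cderive] gives elsewhere. *)
Lemma Ck_onS k F F1 F2 :
  (forall q, D q -> ccontinuous_at F q) ->
  (forall q, D q -> is_cderive F q dir1 (F1 q)) ->
  (forall q, D q -> is_cderive F q dir2 (F2 q)) ->
  Ck_on k D F1 -> Ck_on k D F2 -> Ck_on k.+1 D F.
Proof.
move=> cF d1 d2 h1 h2; split => //; split.
- move=> q Dq; split; [exact: is_cderive_derivable (d1 q Dq)|].
  exact: is_cderive_derivable (d2 q Dq).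
- apply: Ck_on_ext h1 => q; rewrite inE => Dq.
  by rewrite (is_cderive_val (d1 q Dq)).
- apply: Ck_on_ext h2 => q; rewrite inE => Dq.
  by rewrite (is_cderive_val (d2 q Dq)).
Qed.

Lemma Ck_onS_is_cderive k F q : Ck_on k.+1 D F -> D q ->
  is_cderive F q dir1 (cderive dir1 F q) /\ is_cderive F q dir2 (cderive dir2 F q).
Proof. by move=> [_ [dF _ _]] /dF[d1 d2]; split; exact: cderivableP. Qed.

Lemma Ck_onD k F G : Ck_on k D F -> Ck_on k D G ->
  Ck_on k D (fun p => F p + G p).
Proof.
elim: k F G => [|k IH] F G hF hG.
  split => // q Dq.
  by apply: ccontinuousD; [exact: Ck_on_cont hF Dq|exact: Ck_on_cont hG Dq].
have [_ [_ F1 F2]] := hF; have [_ [_ G1 G2]] := hG.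
apply: (Ck_onS _ _ _ (IH _ _ F1 G1) (IH _ _ F2 G2)) => q Dq.
- by apply: ccontinuousD; [exact: Ck_on_cont hF Dq|exact: Ck_on_cont hG Dq].
- apply: is_cderiveD; [exact: (Ck_onS_is_cderive hF Dq).1|].
  exact: (Ck_onS_is_cderive hG Dq).1.
- apply: is_cderiveD; [exact: (Ck_onS_is_cderive hF Dq).2|].
  exact: (Ck_onS_is_cderive hG Dq).2.
Qed.

Lemma Ck_onM k F G : Ck_on k D F -> Ck_on k D G ->
  Ck_on k D (fun p => F p * G p).
Proof.
elim: k F G => [|k IH] F G hF hG.
  split => // q Dq.
  by apply: ccontinuousM; [exact: Ck_on_cont hF Dq|exact: Ck_on_cont hG Dq].
have [_ [_ F1 F2]] := hF; have [_ [_ G1 G2]] := hG.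
have F0 := Ck_onW hF; have G0 := Ck_onW hG.
apply: (Ck_onS _ _ _ (Ck_onD (IH _ _ F1 G0) (IH _ _ F0 G1))
                     (Ck_onD (IH _ _ F2 G0) (IH _ _ F0 G2))) => q Dq.
- by apply: ccontinuousM; [exact: Ck_on_cont hF Dq|exact: Ck_on_cont hG Dq].
- apply: is_cderiveM; [exact: (Ck_onS_is_cderive hF Dq).1|].
  exact: (Ck_onS_is_cderive hG Dq).1.
- apply: is_cderiveM; [exact: (Ck_onS_is_cderive hF Dq).2|].
  exact: (Ck_onS_is_cderive hG Dq).2.
Qed.

Lemma Ck_on_conj k F : Ck_on k D F -> Ck_on k D (fun p => conjc (F p)).
Proof.
elim: k F => [|k IH] F hF.
  by split => // q Dq; exact: ccontinuous_conj (Ck_on_cont hF Dq).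
have [_ [_ F1 F2]] := hF.
apply: (Ck_onS _ _ _ (IH _ F1) (IH _ F2)) => q Dq.
- exact: ccontinuous_conj (Ck_on_cont hF Dq).
- exact: is_cderive_conj (Ck_onS_is_cderive hF Dq).1.
- exact: is_cderive_conj (Ck_onS_is_cderive hF Dq).2.
Qed.

(** Bootstrapping: a continuous solution of a first-order system whose right-hand
sides are as regular as the solution itself gains one degree at each step. *)
Lemma smooth_on_system F F1 F2 :
  (forall q, D q -> ccontinuous_at F q) ->
  (forall q, D q -> is_cderive F q dir1 (F1 q)) ->
  (forall q, D q -> is_cderive F q dir2 (F2 q)) ->
  (forall k, Ck_on k D F -> Ck_on k D F1 /\ Ck_on k D F2) ->
  smooth_on D F.
Proof.
move=> cF d1 d2 h; elim=> [|k IH]; first by split.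
by have [h1 h2] := h k IH; exact: Ck_onS h1 h2.
Qed.

Lemma smooth_on_cst d : smooth_on D (fun=> d).
Proof.
move=> k; elim: k d => [|k IH] d.
  by split => // q _; exact: ccontinuous_cst.
by apply: (Ck_onS _ _ _ (IH 0) (IH 0)) => q _;
  [exact: ccontinuous_cst|exact: is_cderive_cst|exact: is_cderive_cst].
Qed.

Lemma smooth_on_fst : smooth_on D (fun p => (p.1)%:C).
Proof.
apply: (@smooth_on_system _ (fun=> 1) (fun=> 0)).
- by move=> q _; apply: ccontinuous_real; exact: cvg_fst.
- by move=> q _; apply/is_cderive_real/is_derive_fst.
- by move=> q _; apply/is_cderive_real/is_derive_fst.
- by move=> k _; split; exact: smooth_on_cst.
Qed.

Lemma smooth_on_snd : smooth_on D (fun p => (p.2)%:C).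
Proof.
apply: (@smooth_on_system _ (fun=> 0) (fun=> 1)).
- by move=> q _; apply: ccontinuous_real; exact: cvg_snd.
- by move=> q _; apply/is_cderive_real/is_derive_snd.
- by move=> q _; apply/is_cderive_real/is_derive_snd.
- by move=> k _; split; exact: smooth_on_cst.
Qed.

Lemma smooth_onD F G : smooth_on D F -> smooth_on D G ->
  smooth_on D (fun p => F p + G p).
Proof. by move=> hF hG k; exact: Ck_onD. Qed.

Lemma smooth_on_conj F : smooth_on D F -> smooth_on D (fun p => conjc (F p)).
Proof. by move=> hF k; exact: Ck_on_conj. Qed.

Lemma smooth_onM F G : smooth_on D F -> smooth_on D G ->
  smooth_on D (fun p => F p * G p).
Proof. by move=> hF hG k; exact: Ck_onM. Qed.

Lemma smooth_onX F m : smooth_on D F -> smooth_on D (fun p => F p ^+ m).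
Proof.
move=> hF; elim: m => [|m IH]; first exact: smooth_on_cst.
have -> : (fun p => F p ^+ m.+1) = (fun p => F p * F p ^+ m).
  by apply/funext => p; rewrite exprS.
exact: smooth_onM.
Qed.

(** The inverse W of F solves the system dW = - dF W^2, so it bootstraps. *)
Lemma smooth_onV F : (forall q, D q -> F q != 0) -> smooth_on D F ->
  smooth_on D (fun p => (F p)^-1).
Proof.
move=> F0 hF; have [_ [_ dF1 dF2]] := hF 1.
apply: (@smooth_on_system _ (fun q => (- 1) * cderive dir1 F q * ((F q)^-1 * (F q)^-1))
   (fun q => (- 1) * cderive dir2 F q * ((F q)^-1 * (F q)^-1))).
- by move=> q Dq; apply: ccontinuousV; [exact: F0|exact: Ck_on_cont (hF 0) Dq].
- move=> q Dq; apply: is_cderive_eq.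
    by apply: is_cderiveV; [exact: F0|exact: (Ck_onS_is_cderive (hF 1) Dq).1].
  by rewrite mulN1r -invfM.
- move=> q Dq; apply: is_cderive_eq.
    by apply: is_cderiveV; [exact: F0|exact: (Ck_onS_is_cderive (hF 1) Dq).2].
  by rewrite mulN1r -invfM.
- move=> k hk; have [_ [_ F1 F2]] := hF k.+1.
  by split; apply: Ck_onM (Ck_onM hk hk); apply: Ck_onM => //; exact: smooth_on_cst.
Qed.

Lemma smooth_on_linear_system F A1 A2 :
  (forall q, D q -> ccontinuous_at F q) ->
  (forall q, D q -> is_cderive F q dir1 (A1 q * F q)) ->
  (forall q, D q -> is_cderive F q dir2 (A2 q * F q)) ->
  smooth_on D A1 -> smooth_on D A2 -> smooth_on D F.
Proof.
move=> cF d1 d2 h1 h2; apply: (smooth_on_system cF d1 d2) => k hk.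
by split; apply: Ck_onM.
Qed.

End SmoothClosure.

(** * Arguments of complex numbers *)

Section Conj.
Variable R : rcfType.
Implicit Types x y : R[i].

Lemma conjc_mul x y : conjc (x * y) = conjc x * conjc y.
Proof. exact: rmorphM. Qed.

Lemma conjc_add x y : conjc (x + y) = conjc x + conjc y.
Proof. exact: rmorphD. Qed.

Lemma conjc_opp x : conjc (- x) = - conjc x.
Proof. exact: rmorphN. Qed.

Lemma conjc_i : conjc 'i%C = - 'i%C :> R[i].
Proof. by apply/eqP; rewrite eq_complex /= oppr0 !eqxx. Qed.

End Conj.

Section Arguments.
Context {R : realType}.
Implicit Types (z w : R[i]) (s t : R).
Local Notation normc := (@ComplexField.Normc.normc R).

Lemma cisD s t : cis (s + t) = cis s * cis t.
Proof.
rewrite /cis cosD sinD; apply/eqP.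
by rewrite eq_complex /= addrC [_ + cos s * _]addrC !eqxx.
Qed.

Lemma cis0 : cis 0 = 1 :> R[i].
Proof. by rewrite /cis cos0 sin0. Qed.

Lemma cisN t : cis (- t) = conjc (cis t).
Proof. by rewrite /cis cosN sinN. Qed.

Lemma cispi : cis pi = -1 :> R[i].
Proof. by rewrite /cis cospi sinpi; apply/eqP; rewrite eq_complex /= oppr0 !eqxx. Qed.

Lemma conj_cisK t : conjc (cis t) * cis t = 1.
Proof. by rewrite -cisN -cisD addNr cis0. Qed.

Lemma cis_neq0 t : cis t != 0.
Proof.
apply/eqP => h; have := conj_cisK t.
by rewrite h mulr0 => /esym/eqP; rewrite oner_eq0.
Qed.

Lemma normc_cis t : normc (cis t) = 1.
Proof. by rewrite /= cos2Dsin2 sqrtr1. Qed.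

Lemma normc_real t : 0 <= t -> normc t%:C = t.
Proof. by move=> t0; rewrite /= expr0n /= addr0 sqrtr_sqr ger0_norm. Qed.

Lemma normc_ge0 z : 0 <= normc z.
Proof. by case: z => x y; rewrite /= sqrtr_ge0. Qed.

Lemma normc_eq0 z : (normc z == 0) = (z == 0).
Proof.
apply/eqP/eqP; first exact: ComplexField.Normc.eq0_normc.
by move->; rewrite /= expr0n addr0 sqrtr0.
Qed.

Lemma normc_gt0 z : (0 < normc z) = (z != 0).
Proof. by rewrite lt_def normc_eq0 normc_ge0 andbT. Qed.

Lemma normc_conj z : normc (conjc z) = normc z.
Proof. by case: z => x y /=; rewrite sqrrN. Qed.

Lemma sqr_normc z : normc z ^+ 2 = complex.Re z ^+ 2 + complex.Im z ^+ 2.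
Proof. by case: z => x y /=; rewrite sqr_sqrtr // addr_ge0 ?sqr_ge0. Qed.

Lemma normr_Re_le z : `|complex.Re z| <= normc z.
Proof.
rewrite -(ler_pXn2r (ltn0Sn 1)) ?nnegrE ?normr_ge0 ?normc_ge0 //.
by rewrite sqr_normc real_normK ?num_real // lerDl sqr_ge0.
Qed.

Lemma normr_Im_le z : `|complex.Im z| <= normc z.
Proof.
rewrite -(ler_pXn2r (ltn0Sn 1)) ?nnegrE ?normr_ge0 ?normc_ge0 //.
by rewrite sqr_normc real_normK ?num_real // lerDr sqr_ge0.
Qed.

(** An argument is plus or minus the arc cosine of Re z / |z|, according to the
sign of Im z. *)
Lemma exists_arg z : exists t, is_arg z t.
Proof.
have [->|z0] := eqVneq z 0; first by
  exists 0; rewrite /is_arg cis0 mulr1 /= expr0n addr0 sqrtr0.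
have r0 : 0 < normc z by rewrite normc_gt0.
have r2 := sqr_normc z.
have hx : -1 <= complex.Re z / normc z <= 1.
  rewrite -ler_norml normrM normfV (ger0_norm (normc_ge0 z)).
  by rewrite ler_pdivrMr // mul1r normr_Re_le.
have hs : sin (acos (complex.Re z / normc z)) = `|complex.Im z / normc z|.
  rewrite sin_acos // -sqrtr_sqr; congr Num.sqrt.
  rewrite !expr_div_n; apply: (mulIf (lt0r_neq0 (exprn_gt0 2 r0))).
  rewrite mulrBl !divfK ?lt0r_neq0 ?exprn_gt0 //.
  by rewrite mul1r r2 addrC addKr.
have hc : cos (acos (complex.Re z / normc z)) = complex.Re z / normc z by rewrite acosK.
have rn0 := lt0r_neq0 r0.
have [y0|y0] := leP 0 (complex.Im z).
  exists (acos (complex.Re z / normc z)); rewrite /is_arg /cis hs hc.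
  rewrite ger0_norm; last exact: divr_ge0 y0 (ltW r0).
  apply/eqP; rewrite eq_complex complex_ReM complex_ImM /=.
  by apply/andP; split; apply/eqP; field.
exists (- acos (complex.Re z / normc z)); rewrite /is_arg /cis sinN cosN hs hc.
rewrite ler0_norm; last first.
  by rewrite pmulr_lle0 ?invr_gt0 // ltW.
apply/eqP; rewrite eq_complex complex_ReM complex_ImM /=.
by apply/andP; split; apply/eqP; field.
Qed.

Lemma is_arg_conj z t : is_arg z t -> is_arg (conjc z) (- t).
Proof.
rewrite /is_arg normc_conj cisN; move: (normc z) => r ->.
by apply/eqP; rewrite eq_complex /=; apply/andP; split; apply/eqP; ring.
Qed.

Lemma cis_int t (k : int) : cis (t + 2 * pi * k%:~R) = cis t.
Proof.
have aux (m : nat) s : cis (s + 2 * pi * m%:R) = cis s.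
  elim: m => [|m IH]; first by rewrite mulr0 addr0.
  rewrite -[m.+1%:R]natr1 mulrDr mulr1 addrA -[RHS]IH /cis.
  by rewrite mulr_natl cosD2pi sinD2pi.
case: k => m; first exact: aux.
by rewrite NegzE mulrNz mulrN -[LHS](aux m.+1) subrK.
Qed.

(** Reduce t modulo 2 pi to r in [0, 2 pi[; then cos r = 1 means sin (r / 2) = 0,
and the sine is positive inside ]0, pi[. *)
Lemma cis_eq1 t : cis t = 1 -> exists k : int, t = 2 * pi * k%:~R.
Proof.
have pi0 := @pi_gt0 R.
pose k := Num.floor (t / (2 * pi)); pose r := t - 2 * pi * k%:~R.
have tr : t = r + 2 * pi * k%:~R by rewrite subrK.
have p2 : 0 < 2 * pi :> R by rewrite mulr_gt0.
have /andP[r0 r1] : 0 <= r < 2 * pi.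
  have := lt_succ_floor (t / (2 * pi)); rewrite -/k intrD ltr_pdivrMr // => h1.
  have := ge_floor (t / (2 * pi)); rewrite -/k ler_pdivlMr // => h2.
  by rewrite /r; apply/andP; split; lra.
rewrite tr cis_int /cis => -[hc _]; exists k.
suff -> : r = 0 by rewrite add0r.
apply/eqP; rewrite eq_le r0 andbT leNgt; apply/negP => rp.
have s0 : 0 < sin (r / 2) by apply: sin_gt0_pi; lra.
have : cos r = 1 - 2 * sin (r / 2) ^+ 2.
  by rewrite {1}[r]splitr cosD -!expr2 cos2sin2; ring.
by move: s0; set x := sin _ => s0; rewrite hc => h; nra.
Qed.

Lemma is_arg_cis z s t : z != 0 -> is_arg z s -> is_arg z t -> cis s = cis t.
Proof.
move=> z0 hs ht.
have n0 : (normc z)%:C != 0 by rewrite eq_complex /= eqxx andbT normc_eq0.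
by apply: (mulfI n0); rewrite -hs -ht.
Qed.

Lemma is_arg_unique z s t : z != 0 -> is_arg z s -> is_arg z t ->
  exists k : int, t = s + 2 * pi * k%:~R.
Proof.
move=> z0 hs ht; have e := is_arg_cis z0 hs ht.
have /cis_eq1[k hk] : cis (t - s) = 1 by rewrite cisD cisN -e mulrC conj_cisK.
by exists k; rewrite -hk addrC subrK.
Qed.

(** The argument in ]-pi, pi[ of a complex number off the half-line ]-oo, 0], by
the half-angle formula tan (t / 2) = sin t / (1 + cos t). *)
Definition slit_arg w : R := 2 * atan (complex.Im w / (normc w + complex.Re w)).

(** With T = tan (t / 2) the formulas cos t = (1 - T^2) / (1 + T^2) and
sin t = 2 T / (1 + T^2) give back w / |w|. *)
Lemma slit_argP w : 0 < normc w + complex.Re w -> is_arg w (slit_arg w).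
Proof.
move=> d0; have r2 := sqr_normc w; have r0 := normc_ge0 w.
rewrite /is_arg /slit_arg; set T := _ / _.
set x := complex.Re w in r2 d0 *; set y := complex.Im w in r2 *.
set r := normc w in r2 r0 d0 *.
have T2 : 0 < 1 + T ^+ 2 by rewrite ltr_pwDl ?sqr_ge0.
have C2 : cos (atan T) ^+ 2 = (1 + T ^+ 2)^-1.
  by rewrite cos_atan exprVn sqr_sqrtr // ltW.
have C0 : cos (atan T) != 0.
  by apply/lt0r_neq0/cos_gt0_pihalf; rewrite atan_gtNpi2 atan_ltpi2.
have S : sin (atan T) = T * cos (atan T).
  by rewrite -[T in T * _](atanK T) /tan divfK.
have rd : r * (1 + T ^+ 2) = 2 * r ^+ 2 / (r + x).
  have -> : T = y / (r + x) by [].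
  have y2 : y ^+ 2 = r ^+ 2 - x ^+ 2 by rewrite r2 addrC addKr.
  by rewrite expr_div_n y2; field; rewrite lt0r_neq0.
have d0' := lt0r_neq0 d0.
have r_gt0 : 0 < r.
  rewrite lt_def r0 andbT; apply: contraTneq d0 => r0'.
  move: r2; rewrite r0' expr0n => /esym/eqP; rewrite paddr_eq0 ?sqr_ge0 // sqrf_eq0.
  by case/andP => /eqP-> _; rewrite addr0 ltxx.
have rC : r * cos (atan T) ^+ 2 = (r + x) / 2.
  have h : 1 + T ^+ 2 = 2 * r / (r + x).
    by apply: (mulfI (lt0r_neq0 r_gt0)); rewrite rd; field.
  by rewrite C2 h; field; rewrite d0' lt0r_neq0.
have Ty : T * (r + x) = y by rewrite divfK.
rewrite (_ : w = x +i* y); last by rewrite /x /y; case: (w).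
rewrite mulrDl mul1r /cis; apply/eqP; rewrite eq_complex /=.
rewrite !mul0r subr0 addr0 cosD sinD S; apply/andP; split; apply/eqP.
  have -> : r * (cos (atan T) * cos (atan T) - T * cos (atan T) * (T * cos (atan T)))
   = r * cos (atan T) ^+ 2 * (1 - T ^+ 2) by ring.
  rewrite rC; have -> : 1 - T ^+ 2 = 2 - (1 + T ^+ 2) by ring.
  have -> : (r + x) / 2 * (2 - (1 + T ^+ 2)) =
    (r + x) - (r * (1 + T ^+ 2)) * (r + x) / (2 * r).
    by field; rewrite lt0r_neq0.
  by rewrite rd; field; rewrite d0' lt0r_neq0.
have -> : r * (T * cos (atan T) * cos (atan T) + cos (atan T) * (T * cos (atan T)))
   = 2 * T * (r * cos (atan T) ^+ 2) by ring.
by rewrite rC -Ty; field.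
Qed.

(** The argument in ]t0 - pi, t0 + pi[, which is continuous off the half-line
opposite to cis t0. *)
Definition arg_at t0 z : R := t0 + slit_arg (z * cis (- t0)).

(** The complement of that half-line: |w| + Re w > 0 says that w is not a
nonpositive real number. *)
Definition slit_plane t0 : set R[i] :=
  [set z | 0 < normc z + complex.Re (z * cis (- t0))].

Lemma arg_atP t0 z : slit_plane t0 z -> is_arg z (arg_at t0 z).
Proof.
rewrite /slit_plane /= => h.
have nE : normc (z * cis (- t0)) = normc z.
  by rewrite ComplexField.Normc.normcM normc_cis mulr1.
have := @slit_argP (z * cis (- t0)); rewrite nE => /(_ h).
rewrite /is_arg nE /arg_at cisD => e.
by rewrite mulrCA -e mulrCA cisN [cis t0 * _]mulrC conj_cisK mulr1.
Qed.

Lemma slit_plane_arg t0 z : z != 0 -> is_arg z t0 -> slit_plane t0 z.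
Proof.
move=> z0 h; rewrite /slit_plane /= {2}h -mulrA -cisD subrr cis0 mulr1 /=.
by rewrite addr_gt0 ?normc_gt0.
Qed.

Lemma slit_plane_neq0 t0 z : slit_plane t0 z -> z != 0.
Proof.
rewrite /slit_plane /= => h; apply: contraTneq h => ->.
by rewrite mul0r ComplexField.Normc.normc0 addr0 ltxx.
Qed.

End Arguments.

(** * Continuous functions with countably many values; branches of powers *)

(** A nondegenerate segment has positive length, a countable set has none. *)
Lemma countable_itv_eq (R : realType) (A : set R) (x y : R) :
  countable A -> `[x, y] `<=` A -> y <= x.
Proof.
move=> cA sub; rewrite leNgt; apply/negP => xy.
have c : countable `[x, y]%classic by exact: sub_countable (subset_card_le sub) cA.
have := countable_lebesgue_measure0 c.
rewrite lebesgue_measure_itv /= lte_fin xy -EFinD => /eqP.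
by rewrite eqe subr_eq0 => /eqP e; move: xy; rewrite e ltxx.
Qed.

(** If f took two values on the segment from q to p, it would take all the values
between them, which are uncountably many. *)
Lemma countable_image_constant (R : realType) (V : normedModType R)
    (f : V -> R) (S : set R) (q : V) (e : R) :
  countable S -> (forall p, ball q e p -> {for p, continuous f}) ->
  (forall p, ball q e p -> S (f p)) -> forall p, ball q e p -> f p = f q.
Proof.
move=> cS cf Sf p qp.
have e0 : 0 < e by move: qp; rewrite -ball_normE /= => /(le_lt_trans (normr_ge0 _)).
pose l (t : R) := q + t *: (p - q).
have bl t : t \in `[0, 1] -> ball q e (l t).
  rewrite in_itv /= => /andP[t0 t1]; move: qp; rewrite -ball_normE /= /l => qp.
  rewrite opprD addrA subrr add0r normrN normrZ ger0_norm // -normrN opprB.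
  by apply: le_lt_trans qp; rewrite ler_piMl.
have cl : {within `[0, 1], continuous (f \o l)}.
  apply: continuous_in_subspaceT => t; rewrite inE => t01.
  apply: continuous_comp; last exact/cf/bl.
  apply: continuousD; first exact: cvg_cst.
  apply: (@continuousZ _ _ _ (fun t : R => t) (fun=> p - q)); first exact: cvg_id.
  exact: cvg_cst.
have l0 : l 0 = q by rewrite /l scale0r addr0.
have l1 : l 1 = p by rewrite /l scale1r addrC subrK.
have sub : `[Order.min (f q) (f p), Order.max (f q) (f p)] `<=` S.
  move=> y; rewrite /= in_itv /= => hy.
  have [||t t01 <-] := IVT _ cl (v := y); rewrite /= ?l0 ?l1 ?ler01 //.
  exact/Sf/bl.
have := countable_itv_eq cS sub.
by rewrite ge_max !le_min !lexx /= andbT => h; apply/eqP; rewrite eq_le andbC.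
Qed.

Section PowerBranch.
Context {R : realType}.
Variables al be : R.
Local Notation normc := (@ComplexField.Normc.normc R).
Implicit Types (F G : R * R -> R[i]) (q v : R * R) (z : R[i]).

(** The branch of z^al (conj z)^be on the slit plane centred at t0: arg (conj z) is
- arg z, so the exponents add up on the modulus and subtract on the argument. *)
Definition power_branch (t0 : R) z : R[i] :=
  (normc z `^ (al + be))%:C * cis ((al - be) * arg_at t0 z).

Lemma normc_sqr_modulus F p : sqr_modulus F p = normc (F p) ^+ 2.
Proof. by rewrite sqr_normc. Qed.

Lemma normc_fun F : (fun p => normc (F p)) = Num.sqrt \o sqr_modulus F.
Proof.
apply/funext => p.
by rewrite /= normc_sqr_modulus sqrtr_sqr ger0_norm // normc_ge0.
Qed.

Lemma continuous_normc F q : ccontinuous_at F q ->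
  {for q, continuous (fun p => normc (F p))}.
Proof.
move=> cF; rewrite normc_fun.
apply: continuous_comp; last exact: sqrt_continuous.
exact: continuous_sqr_modulus.
Qed.

Lemma ccontinuous_cis (u : R * R -> R) q : {for q, continuous u} ->
  ccontinuous_at (fun p => cis (u p)) q.
Proof.
move=> hu; split => /=.
  by apply: (@continuous_comp _ _ _ u cos) => //; exact: continuous_cos.
by apply: (@continuous_comp _ _ _ u sin) => //; exact: continuous_sin.
Qed.

Lemma continuous_arg_at F q t0 : ccontinuous_at F q -> slit_plane t0 (F q) ->
  {for q, continuous (fun p => arg_at t0 (F p))}.
Proof.
rewrite /slit_plane /= => cF h.
have cw := ccontinuousM cF (ccontinuous_cst (cis (- t0)) q).
have nE p : normc (F p * cis (- t0)) = normc (F p).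
  by rewrite ComplexField.Normc.normcM normc_cis mulr1.
apply: continuousD; first exact: cvg_cst.
apply: continuousM; first exact: cvg_cst.
apply: (@continuous_comp _ _ _ (fun p => complex.Im (F p * cis (- t0)) /
  (normc (F p * cis (- t0)) + complex.Re (F p * cis (- t0)))) atan); last first.
  exact: continuous_atan.
apply: continuousM; first exact: cw.2.
apply: cvgV; first by rewrite nE lt0r_neq0.
by apply: continuousD; [exact: continuous_normc|exact: cw.1].
Qed.

Lemma continuous_powR_normc F q s : ccontinuous_at F q -> F q != 0 ->
  {for q, continuous (fun p => normc (F p) `^ s)}.
Proof.
move=> cF F0; apply: (@continuous_comp _ _ _ (fun p => normc (F p)) (fun x => x `^ s)).
  exact: continuous_normc.
apply: differentiable_continuous; apply/derivable1_diffP.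
by apply: derivable_powR; rewrite in_itv /= andbT normc_gt0.
Qed.

Lemma ccontinuous_power_branch F q t0 : ccontinuous_at F q ->
  slit_plane t0 (F q) -> ccontinuous_at (fun p => power_branch t0 (F p)) q.
Proof.
move=> cF h; apply: ccontinuousM.
  by apply/ccontinuous_real/continuous_powR_normc => //; exact: slit_plane_neq0 h.
apply: ccontinuous_cis; apply: continuousM; first exact: cvg_cst.
exact: continuous_arg_at.
Qed.

Lemma power_branch_neq0 t0 z : z != 0 -> power_branch t0 z != 0.
Proof.
move=> z0; rewrite mulf_neq0 ?cis_neq0 // eq_complex /= eqxx andbT.
by rewrite gt_eqF // powR_gt0 // normc_gt0.
Qed.

Lemma is_derive_normc F q v d : F q != 0 -> is_cderive F q v d ->
  is_derive q v (fun p => normc (F p)) (normc (F q) * complex.Re (d / F q)).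
Proof.
move=> F0 dF; have r0 : 0 < normc (F q) by rewrite normc_gt0.
have m0 : 0 < sqr_modulus F q by rewrite normc_sqr_modulus exprn_gt0.
rewrite normc_fun.
apply: is_derive_eq (is_derive_comp1 (is_derive1_sqrt m0) (is_derive_sqr_modulus dF)) _.
rewrite normc_sqr_modulus sqrtr_sqr ger0_norm ?(ltW r0) //.
rewrite complex_ReM complex_invE -sqr_normc /=.
by field; exact: lt0r_neq0.
Qed.

(** Since t0 is an argument of F q, the derivative is taken at the centre of the
slit plane: w = F cis (- t0) is a positive real number at q, the tangent of the
half-angle vanishes there, and the derivative of the argument is Im dw / w. *)
Lemma is_derive_arg_at F q v d t0 : F q != 0 -> is_arg (F q) t0 ->
  is_cderive F q v d ->
  is_derive q v (fun p => arg_at t0 (F p)) (complex.Im (d / F q)).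
Proof.
move=> F0 hF dF; have r0 : 0 < normc (F q) by rewrite normc_gt0.
pose W p := F p * cis (- t0).
have dW : is_cderive W q v (d * cis (- t0)).
  by apply: is_cderive_eq (is_cderiveM dF (is_cderive_cst _ _ _)) _; rewrite mulr0 addr0.
have WE : W q = (normc (F q))%:C by rewrite /W {1}hF -mulrA -cisD subrr cis0 mulr1.
have W0 : W q != 0 by rewrite mulf_neq0 ?cis_neq0.
have dn := is_derive_normc W0 dW.
have dD := is_deriveD dn dW.1.
pose Dn := (fun p => normc (W p)) + (fun p => complex.Re (W p)).
have DnE : Dn q = normc (F q) + normc (F q).
  rewrite -[LHS]/(normc (W q) + complex.Re (W q)) WE normc_real //.
  exact: ltW.
have D0 : Dn q != 0 by rewrite DnE lt0r_neq0 // addr_gt0.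
have dT := is_deriveM dW.2 (is_derive_inv (u := Dn) D0 dD).
have dA := is_derive_comp1 (is_derive1_atan _) dT.
have dA2 := is_deriveD (is_derive_cst t0 q v) (is_deriveM (is_derive_cst (2 : R) q v) dA).
have T0 : ((fun p => complex.Im (W p)) * (fun p => (Dn p)^-1)) q = 0.
  by rewrite -[LHS]/(complex.Im (W q) * (Dn q)^-1) WE mul0r.
have -> : d / F q = d * cis (- t0) / W q.
  by rewrite /W -mulf_div divff ?cis_neq0 // mulr1.
move: (d * cis (- t0)) dA2 => [x y] dA2.
apply: is_derive_eq dA2 _.
rewrite !scaleRE T0 DnE WE complex_ImM complex_invE /=.
by field; rewrite !lt0r_neq0 ?addr_gt0.
Qed.

(** The logarithmic derivative of z^al (conj z)^be, obtained from those of the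
modulus and of the argument, Re (dz / z) and Im (dz / z). *)
Lemma is_cderive_power_branch F q v d t0 : F q != 0 -> is_arg (F q) t0 ->
  is_cderive F q v d ->
  is_cderive (fun p => power_branch t0 (F p)) q v
    ((al%:C * (d / F q) + be%:C * conjc (d / F q)) * power_branch t0 (F q)).
Proof.
move=> F0 hF dF; have r0 : 0 < normc (F q) by rewrite normc_gt0.
have dn := is_derive_normc F0 dF.
have da := is_deriveM (is_derive_cst (al - be) q v) (is_derive_arg_at F0 hF dF).
have dp := is_derive_comp1 (is_derive1_powR (al + be) r0) dn.
have dc : is_cderive (fun p => cis ((al - be) * arg_at t0 (F p))) q v
   ('i%C * ((al - be) * complex.Im (d / F q))%:C * cis ((al - be) * arg_at t0 (F q))).
  split.
    apply: is_derive_eq (is_derive_comp1 (is_derive_cos _) da) _.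
    by rewrite !scaleRE /=; ring.
  apply: is_derive_eq (is_derive_comp1 (is_derive_sin _) da) _.
  by rewrite !scaleRE /=; ring.
apply: is_cderive_eq (is_cderiveM (is_cderive_real dp) dc) _.
rewrite powRB; last by rewrite (gt_eqF r0) implybT.
rewrite powRr1 ?(ltW r0) // /power_branch /=.
set P := _ `^ _; set E := cis _.
move: (d / F q) => [x y] /=.
have rn0 := lt0r_neq0 r0.
have -> : (al + be) * (P / normc (F q)) * (normc (F q) * x) = (al + be) * x * P by field.
case: E => e1 e2; apply/eqP; rewrite eq_complex /=; apply/andP; split; apply/eqP; ring.
Qed.

End PowerBranch.

Section BranchValues.
Context {R : realType}.
Variables al be : R.
Local Notation normc := (@ComplexField.Normc.normc R).
Implicit Types (F G : R * R -> R[i]) (q v : R * R) (z w : R[i]).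

(** The values of z^al (conj z)^be, with the second argument counted as one of z:
the two factors of the product may use different arguments. *)
Definition power_values z : set R[i] :=
  [set w | exists t t', [/\ is_arg z t, is_arg z t' &
     w = (normc z `^ (al + be))%:C * cis (al * t - be * t')]].

Lemma cpow_values_mul z w1 w2 : al + be != 0 ->
  cpow_values z al w1 -> cpow_values (conjc z) be w2 ->
  power_values z (w1 * w2).
Proof.
move=> ab [t ht ->] [t' ht' ->]; exists t, (- t'); split => //.
  by have := is_arg_conj ht'; rewrite conjcK.
rewrite normc_conj powRD ?(negPf ab) // mulrN opprK cisD rmorphM /=.
by rewrite mulrACA.
Qed.

Lemma power_values_cpow z t : al + be != 0 -> is_arg z t ->
  exists w1 w2, [/\ cpow_values z al w1, cpow_values (conjc z) be w2 &
     (normc z `^ (al + be))%:C * cis ((al - be) * t) = w1 * w2].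
Proof.
move=> ab ht; exists ((normc z `^ al)%:C * cis (al * t)),
  ((normc z `^ be)%:C * cis (be * - t)); split.
- by exists t.
- by exists (- t); [exact: is_arg_conj|rewrite normc_conj].
- rewrite powRD ?(negPf ab) // mulrACA -cisD rmorphM; congr (_ * cis _); ring.
Qed.

Lemma normc_power_values z w : power_values z w -> normc w = normc z `^ (al + be).
Proof.
move=> [t [t' [_ _ ->]]].
by rewrite ComplexField.Normc.normcM normc_cis mulr1 normc_real // powR_ge0.
Qed.

Lemma power_values_branch z w t0 : slit_plane t0 z -> power_values z w ->
  exists k k' : int,
    w = power_branch al be t0 z * cis (2 * pi * (al * k%:~R - be * k'%:~R)).
Proof.
move=> hz [t [t' [ht ht' ->]]]; have z0 := slit_plane_neq0 hz.
have [k ->] := is_arg_unique z0 (arg_atP hz) ht.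
have [k' ->] := is_arg_unique z0 (arg_atP hz) ht'.
exists k, k'; rewrite /power_branch -[RHS]mulrA -cisD; congr (_ * cis _); ring.
Qed.

Lemma near_slit_plane G q t0 : ccontinuous_at G q -> slit_plane t0 (G q) ->
  \near q, slit_plane t0 (G q).
Proof.
move=> cG h.
have cw := ccontinuousM cG (ccontinuous_cst (cis (- t0)) q).
have c : {for q, continuous (fun p => normc (G p) + complex.Re (G p * cis (- t0)))}.
  by apply: continuousD; [exact: continuous_normc|exact: cw.1].
exact: (cvgr_gt _ c 0 h).
Qed.

(** The ratio of F to the branch built from [arg_at] is continuous near q and takes
only the values cis (2 pi (al k - be k')), for integers k and k'. *)
Lemma branch_ratio_locally_constant (D : set (R * R)) F G q t0 :
  open D -> D q -> (forall p, D p -> ccontinuous_at F p) ->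
  (forall p, D p -> ccontinuous_at G p) ->
  (forall p, D p -> power_values (G p) (F p)) ->
  slit_plane t0 (G q) ->
  \forall p \near q,
    F q / power_branch al be t0 (G q) * power_branch al be t0 (G p) = F p.
Proof.
move=> Do Dq cF cG vF hq.
have nD : \near q, D q by exact: open_nbhs_nbhs.
have : \near q, (D q /\ slit_plane t0 (G q)).
  by apply: filterI => //; apply: near_slit_plane => //; exact: cG.
move=> /nbhs_ballP[e e0 sub].
pose Q p := F p / power_branch al be t0 (G p).
pose om (k : int * int) : R := 2 * pi * (al * k.1%:~R - be * k.2%:~R).
have QE p : ball q e p -> exists k, Q p = cis (om k).
  move=> /sub[Dp sp]; have [k [k' Fp]] := power_values_branch sp (vF p Dp).
  exists (k, k'); rewrite /Q Fp /om mulrAC divff ?mul1r //.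
  by apply: power_branch_neq0; exact: slit_plane_neq0 sp.
have cQ p : ball q e p -> ccontinuous_at Q p.
  move=> /sub[Dp sp]; apply: ccontinuousM; first exact: cF.
  apply: ccontinuousV; first by apply: power_branch_neq0; exact: slit_plane_neq0 sp.
  by apply: ccontinuous_power_branch => //; exact: cG.
have cst p : ball q e p -> Q p = Q q.
  move=> bp; apply/eqP; rewrite eq_complex; apply/andP; split; apply/eqP.
    apply: (@countable_image_constant _ (R * R)%type (fun p => complex.Re (Q p))
      (range (cos \o om)) q e) => //.
    - exact: sub_countable (card_image_le _ _) (countableP _).
    - by move=> p' /cQ[].
    - by move=> p' /QE[k ->]; exists k.
  apply: (@countable_image_constant _ (R * R)%type (fun p => complex.Im (Q p))
      (range (sin \o om)) q e) => //.
  - exact: sub_countable (card_image_le _ _) (countableP _).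
  - by move=> p' /cQ[].
  - by move=> p' /QE[k ->]; exists k.
apply/nbhs_ballP; exists e => // p bp /=.
rewrite -[F q / _]/(Q q) -(cst p bp) /Q divfK //.
by apply: power_branch_neq0; have [_ /slit_plane_neq0] := sub _ bp.
Qed.

Lemma is_cderive_branch (D : set (R * R)) F G q v d :
  open D -> D q -> (forall p, D p -> ccontinuous_at F p) ->
  (forall p, D p -> ccontinuous_at G p) ->
  (forall p, D p -> power_values (G p) (F p)) ->
  G q != 0 -> is_cderive G q v d ->
  is_cderive F q v ((al%:C * (d / G q) + be%:C * conjc (d / G q)) * F q).
Proof.
move=> Do Dq cF cG vF Gq dG.
have [t0 ht0] := exists_arg (G q).
have hs := slit_plane_arg Gq ht0.
apply: is_cderive_near (branch_ratio_locally_constant Do Dq cF cG vF hs) _.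
apply: is_cderive_eq (is_cderiveM (is_cderive_cst _ _ _)
  (is_cderive_power_branch al be Gq ht0 dG)) _.
rewrite mul0r add0r mulrCA; congr (_ * _).
by rewrite divfK // power_branch_neq0.
Qed.

End BranchValues.

(** * The functions g and h *)

Section GrushinSolution.
Context {R : realType}.
Variables (n : nat) (a b c L : R).
Hypothesis c_neq0 : c != 0.
Local Notation normc := (@ComplexField.Normc.normc R).
Local Notation al := ((1 + L) / (2 * n + 2)%N%:R).
Local Notation be := ((1 - L) / (2 * n + 2)%N%:R).
Local Notation g := (g_fun n a b c).
Implicit Types (q : R * R) (F : R * R -> R[i]).

Lemma h_funE q : h_fun n a b c q = conjc (g q).
Proof.
rewrite /h_fun /g_fun; apply/eqP; rewrite eq_complex /=.
by apply/andP; split; apply/eqP; ring.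
Qed.

Lemma Re_g q : complex.Re (g q) = c * (q.1 - a) ^+ n.+1.
Proof. by rewrite /g_fun /=; ring. Qed.

Lemma Im_g q : complex.Im (g q) = n.+1%:R * (q.2 - b).
Proof. by rewrite /g_fun /=; ring. Qed.

Lemma g_eq0 q : (g q == 0) = (q == (a, b)).
Proof.
rewrite eq_complex Re_g Im_g /= !mulf_eq0 (negPf c_neq0) expf_eq0 /= pnatr_eq0 /=.
by rewrite !subr_eq0 [RHS]xpair_eqE.
Qed.

Lemma exponentsD : al + be = n.+1%:R^-1.
Proof.
rewrite (_ : (2 * n + 2)%N = (2 * n.+1)%N); last by rewrite mulnS addnC.
have N0 : n.+1%:R != 0 :> R by rewrite pnatr_eq0.
by rewrite natrM; move: (n.+1%:R) N0 => N N0; field.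
Qed.

Lemma exponentsB : al - be = L / n.+1%:R.
Proof.
rewrite (_ : (2 * n + 2)%N = (2 * n.+1)%N); last by rewrite mulnS addnC.
have N0 : n.+1%:R != 0 :> R by rewrite pnatr_eq0.
by rewrite natrM; move: (n.+1%:R) N0 => N N0; field.
Qed.

Lemma exponents_neq0 : al + be != 0.
Proof. by rewrite exponentsD invr_neq0 // pnatr_eq0. Qed.

Lemma f_infty_values_power q w :
  f_infty_values n a b c L q w -> power_values al be (g q) w.
Proof.
move=> [w1 [w2 [h1 h2 ->]]]; rewrite h_funE in h2.
exact: cpow_values_mul exponents_neq0 h1 h2.
Qed.

Lemma f_infty_values_arg q t : is_arg (g q) t ->
  f_infty_values n a b c L q ((normc (g q) `^ (al + be))%:C * cis ((al - be) * t)).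
Proof.
move=> /(power_values_cpow exponents_neq0)[w1 [w2 [h1 h2 e]]].
by exists w1, w2; rewrite h_funE.
Qed.

(** The derivative Y1 g, written s in the formulas above. *)
Definition dg q : R := c * n.+1%:R * (q.1 - a) ^+ n.

Lemma smooth_on_real_fst (D : set (R * R)) m : open D ->
  smooth_on D (fun p => ((p.1 - a) ^+ m)%:C).
Proof.
move=> Do.
have -> : (fun p : R * R => ((p.1 - a) ^+ m)%:C) = (fun p => ((p.1)%:C + (- a)%:C) ^+ m).
  by apply/funext => p; rewrite rmorphXn rmorphD.
apply: smooth_onX => //; apply: smooth_onD => //; first exact: smooth_on_fst.
exact: smooth_on_cst.
Qed.

Lemma smooth_on_g (D : set (R * R)) : open D -> smooth_on D g.
Proof.
move=> Do.
have -> : g = (fun p => c%:C * ((p.1 - a) ^+ n.+1)%:C +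
    'i%C * n.+1%:R%:C * ((p.2)%:C + (- b)%:C)).
  by apply/funext => p; rewrite /g_fun !rmorphM rmorphB rmorphN mulrA.
apply: smooth_onD => //; apply: smooth_onM => //.
- exact: smooth_on_cst.
- exact: smooth_on_real_fst.
- exact: smooth_on_cst.
- by apply: smooth_onD => //; [exact: smooth_on_snd|exact: smooth_on_cst].
Qed.

Lemma ccontinuous_g q : ccontinuous_at g q.
Proof. exact: Ck_on_cont (smooth_on_g openT 0) I. Qed.

Lemma smooth_on_dg (D : set (R * R)) : open D -> smooth_on D (fun p => (dg p)%:C).
Proof.
move=> Do.
have -> : (fun p => (dg p)%:C) = (fun p => (c * n.+1%:R)%:C * ((p.1 - a) ^+ n)%:C).
  by apply/funext => p; rewrite /dg rmorphM.
by apply: smooth_onM => //; [exact: smooth_on_cst|exact: smooth_on_real_fst].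
Qed.

Lemma is_derive_fstX q v m :
  is_derive q v (fun p : R * R => (p.1 - a) ^+ m) (m%:R * (q.1 - a) ^+ m.-1 * v.1).
Proof.
have -> : (fun p : R * R => (p.1 - a) ^+ m) = ((fun p : R * R => p.1) + cst (- a)) ^+ m.
  by apply/funext => p; rewrite exprfctE.
apply: is_derive_eq (is_deriveX m (is_deriveD (is_derive_fst q v)
  (is_derive_cst (- a) q v))) _.
by rewrite scaleRE addr0.
Qed.

Lemma is_cderive_g1 q : is_cderive g q dir1 (dg q)%:C.
Proof.
have h := is_deriveM (is_derive_cst c q dir1) (is_derive_fstX q dir1 n.+1).
have h2 := is_deriveM (is_derive_cst (n.+1%:R : R) q dir1)
  (is_deriveD (is_derive_snd q dir1) (is_derive_cst (- b) q dir1)).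
apply: is_cderive_eq (is_cderiveD (is_cderive_real h)
  (is_cderiveM (is_cderive_cst 'i%C _ _) (is_cderive_real h2))) _.
rewrite !scaleRE /dg /=; apply/eqP; rewrite eq_complex /=; apply/andP; split; apply/eqP; ring.
Qed.

Lemma is_cderive_g2 q : is_cderive g q dir2 ('i%C * n.+1%:R%:C).
Proof.
have h := is_deriveM (is_derive_cst c q dir2) (is_derive_fstX q dir2 n.+1).
have h2 := is_deriveM (is_derive_cst (n.+1%:R : R) q dir2)
  (is_deriveD (is_derive_snd q dir2) (is_derive_cst (- b) q dir2)).
apply: is_cderive_eq (is_cderiveD (is_cderive_real h)
  (is_cderiveM (is_cderive_cst 'i%C _ _) (is_cderive_real h2))) _.
rewrite !scaleRE /=; apply/eqP; rewrite eq_complex /=; apply/andP; split; apply/eqP; ring.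
Qed.

Lemma is_cderive_dg q v :
  is_cderive (fun p => (dg p)%:C) q v (c * n.+1%:R * (n%:R * (q.1 - a) ^+ n.-1) * v.1)%:C.
Proof.
apply: is_cderive_real.
apply: is_derive_eq (is_deriveM (is_derive_cst (c * n.+1%:R) q v)
  (is_derive_fstX q v n)) _.
by rewrite !scaleRE /=; ring.
Qed.

End GrushinSolution.

(** * The equation satisfied by a branch *)

(** The operator applied to a branch, with z = g, z' = h, f' = conj f, S = s,
T = ds/dy1, P = c (y1 - a)^n, x = y1 - a and m = n. It is a multiple of
2 T (z + z') + S^2 (A + B - 1) ((z + z')^2 + i^2 (z' - z)^2) / (z z'); the last
quotient is 4, and the rest reduces to 4 P S (m + 1 - N) = 0. *)
Lemma infty_laplacian_algebra (K : fieldType) (z z' f f' S T P N A B k k' i x m : K) :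
  z != 0 -> z' != 0 -> i ^+ 2 = -1 -> S = P * N -> z + z' = 2 * (x * P) ->
  x * T = m * S -> N * (A + B) = 1 -> N = m + 1 ->
  k' * ((T * S + S * T) * (f * f' * (z * z')^-1) + S * S *
    (((A * (S * z^-1) + B * (S * z'^-1)) * f * f'
      + f * ((A * (S * z'^-1) + B * (S * z^-1)) * f')) * (z * z')^-1
    + f * f' * (- (S * z' + z * S) / (z * z') ^+ 2)))
  * (k * S * (z^-1 + z'^-1) * f)
  + P * (k' * (S * S *
    ((i * (A * (N * z^-1) + - B * (N * z'^-1)) * f * f'
      + f * (- i * (A * (N * z'^-1) + - B * (N * z^-1)) * f')) * (z * z')^-1
    + f * f' * (- (i * N * z' + z * (- i * N)) / (z * z') ^+ 2))))
  * (i * (k * S * (z^-1 - z'^-1) * f)) = 0.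
Proof.
move=> z0 z0' i2 SE zz xT NAB NE.
transitivity (k * k' * S ^+ 2 * f ^+ 2 * f' / (z * z') ^+ 2 *
  (2 * T * (z + z') + S ^+ 2 * (A + B - 1) *
    (((z + z') ^+ 2 + i ^+ 2 * (z' - z) ^+ 2) / (z * z')))).
  by rewrite SE; field; rewrite z0 z0'.
have -> : ((z + z') ^+ 2 + i ^+ 2 * (z' - z) ^+ 2) / (z * z') = 4.
  by rewrite i2; field; rewrite z0 z0'.
rewrite zz (_ : _ + _ = 0) ?mulr0 //.
have -> : S ^+ 2 * (A + B - 1) * 4 = 4 * S * P * (N * (A + B) - N) by rewrite SE; ring.
have -> : 2 * T * (2 * (x * P)) = 4 * P * (x * T) by ring.
by rewrite xT NAB NE; ring.
Qed.

Section BranchEquation.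
Context {R : realType}.
Variables (n : nat) (a b c L : R).
Hypothesis c_neq0 : c != 0.
Local Notation normc := (@ComplexField.Normc.normc R).
Local Notation al := ((1 + L) / (2 * n + 2)%N%:R).
Local Notation be := ((1 - L) / (2 * n + 2)%N%:R).
Local Notation g := (g_fun n a b c).
Local Notation s := (dg n a c).
Local Notation N := (n.+1%:R : R).
Local Notation kappa := ((1 - L ^+ 2) / (2 * n + 2)%N%:R).
Variables (D : set (R * R)) (F : R * R -> R[i]).
Hypothesis Do : open D.
Hypothesis Dpunct : D `<=` [set q | q <> (a, b)].
Hypothesis Fbranch : f_infty_branch n a b c L D F.
Implicit Types q : R * R.

Lemma g_neq0 q : D q -> g q != 0.
Proof. by move=> Dq; rewrite g_eq0 //; apply/eqP; exact: Dpunct. Qed.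

Lemma conj_g_neq0 q : D q -> conjc (g q) != 0.
Proof. by move=> Dq; rewrite conjc_eq0 g_neq0. Qed.

(** The logarithmic derivatives of a branch in the two coordinate directions. *)
Definition coef1 q : R[i] :=
  al%:C * ((s q)%:C * (g q)^-1) + be%:C * ((s q)%:C * (conjc (g q))^-1).

Definition coef2 q : R[i] :=
  'i%C * (al%:C * (N%:C * (g q)^-1) + (- be%:C) * (N%:C * (conjc (g q))^-1)).

Lemma is_cderive_branch_g q v d : D q -> is_cderive g q v d ->
  is_cderive F q v ((al%:C * (d / g q) + be%:C * conjc (d / g q)) * F q).
Proof.
move=> Dq; have [Fv Fc] := Fbranch.
apply: (is_cderive_branch Do Dq Fc _ _ (g_neq0 Dq)).
- by move=> p _; exact: ccontinuous_g.
- by move=> p _; exact: f_infty_values_power (Fv p).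
Qed.

Lemma is_cderive_branch1 q : D q -> is_cderive F q dir1 (coef1 q * F q).
Proof.
move=> Dq; apply: is_cderive_eq (is_cderive_branch_g Dq (is_cderive_g1 n a b c q)) _.
by rewrite conjc_mul conjc_inv conjc_real.
Qed.

Lemma is_cderive_branch2 q : D q -> is_cderive F q dir2 (coef2 q * F q).
Proof.
move=> Dq; apply: is_cderive_eq (is_cderive_branch_g Dq (is_cderive_g2 n a b c q)) _.
rewrite !conjc_mul conjc_inv conjc_real /coef2 conjc_i.
by congr (_ * _); ring.
Qed.

Lemma smooth_on_branch : smooth_on D F.
Proof.
have hg := smooth_on_g n a b c Do; have hs := smooth_on_dg n a c Do.
have hgV := smooth_onV Do g_neq0 hg.
have hhV := smooth_onV Do conj_g_neq0 (smooth_on_conj Do hg).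
apply: (smooth_on_linear_system Do Fbranch.2 is_cderive_branch1 is_cderive_branch2).
  by apply: smooth_onD => //; apply: smooth_onM (smooth_on_cst _ _) _ => //; apply: smooth_onM.
apply: smooth_onM (smooth_on_cst _ _) _ => //.
by apply: smooth_onD => //; apply: smooth_onM (smooth_on_cst _ _) _ => //;
  apply: smooth_onM (smooth_on_cst _ _) _.
Qed.

Lemma xi1_branch q : D q -> xi1 n a c L F q =
  kappa%:C * (s q)%:C * ((g q)^-1 + (conjc (g q))^-1) * F q.
Proof.
move=> Dq; rewrite /xi1 /Y2 /Y1 (is_cderive_val (is_cderive_branch1 Dq)).
rewrite (is_cderive_val (is_cderive_branch2 Dq)).
rewrite /coef1 /coef2.
have -> : (s q)%:C = (c * (q.1 - a) ^+ n)%:C * N%:C.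
  by rewrite -rmorphM /dg mulrAC.
move: (c * _)%:C N%:C (g q)^-1 (conjc (g q))^-1 (F q) => S M G H f.
have -> : 'i%C * L%:C * (S * ('i%C * (al%:C * (M * G) + - be%:C * (M * H)) * f)) =
  - L%:C * S * M * (al%:C * G - be%:C * H) * f.
  transitivity ('i%C ^+ 2 * (L%:C * S * M * (al%:C * G - be%:C * H) * f)); first by ring.
  by rewrite sqr_i; ring.
have -> : kappa = al * (1 - L) by ring.
have -> : be%:C = (1 - L)%:C * ((2 * n + 2)%N%:R^-1)%:C by rewrite -rmorphM.
rewrite !rmorphM rmorphD rmorphB rmorph1.
by ring.
Qed.

Lemma xi2_branch q : D q -> xi2 n a c L F q =
  'i%C * (kappa%:C * (s q)%:C * ((g q)^-1 - (conjc (g q))^-1) * F q).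
Proof.
move=> Dq; rewrite /xi2 /Y2 /Y1 (is_cderive_val (is_cderive_branch1 Dq)).
rewrite (is_cderive_val (is_cderive_branch2 Dq)).
rewrite /coef1 /coef2.
have -> : (s q)%:C = (c * (q.1 - a) ^+ n)%:C * N%:C.
  by rewrite -rmorphM /dg mulrAC.
move: (c * _)%:C N%:C (g q)^-1 (conjc (g q))^-1 (F q) => S M G H f.
have -> : kappa = al * (1 - L) by ring.
have -> : be%:C = (1 - L)%:C * ((2 * n + 2)%N%:R^-1)%:C by rewrite -rmorphM.
rewrite !rmorphM rmorphD rmorphB rmorph1.
by ring.
Qed.

(** The squared norm of xi on D. *)
Definition xi_density q : R[i] :=
  (4 * kappa ^+ 2)%:C *
  ((s q)%:C * (s q)%:C * ((F q * conjc (F q)) * (g q * conjc (g q))^-1)).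

Lemma xi_norm2_branch q : D q -> xi_norm2 n a c L F q = xi_density q.
Proof.
move=> Dq; rewrite /xi_norm2 xi1_branch // xi2_branch // /xi_density.
rewrite invfM (_ : (4 * kappa ^+ 2)%:C = 4 * kappa%:C ^+ 2); last first.
  by rewrite rmorphM rmorphXn /= rmorph_nat.
move: (g q) (F q) kappa (s q) => z f k S.
rewrite !conjc_mul !conjc_add conjc_opp !conjc_inv conjcK !conjc_real conjc_i.
move: z^-1 (conjc z)^-1 (conjc f) k%:C S%:C => G H f' {}k {}S.
transitivity (k * S * (G + H) * f * (k * S * (H + G) * f') - 'i%C ^+ 2 *
  ((k * S * (G - H) * f) * (k * S * (H - G) * f'))); first by ring.
by rewrite sqr_i; ring.
Qed.

Lemma is_cderive_xi_density q v ds dz df : D q ->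
  is_cderive (fun p => (s p)%:C) q v ds -> is_cderive g q v dz ->
  is_cderive F q v df ->
  is_cderive (xi_norm2 n a c L F) q v ((4 * kappa ^+ 2)%:C *
    ((ds * (s q)%:C + (s q)%:C * ds) * (F q * conjc (F q) * (g q * conjc (g q))^-1)
     + (s q)%:C * (s q)%:C *
      ((df * conjc (F q) + F q * conjc df) * (g q * conjc (g q))^-1
       + F q * conjc (F q) *
         (- (dz * conjc (g q) + g q * conjc dz) / (g q * conjc (g q)) ^+ 2)))).
Proof.
move=> Dq hs hz hf.
apply: (@is_cderive_near _ xi_density).
  apply: filterS (open_nbhs_nbhs (conj Do Dq)) => p Dp.
  by rewrite xi_norm2_branch.
have gg0 : g q * conjc (g q) != 0 by rewrite mulf_neq0 ?g_neq0 ?conj_g_neq0.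
have hzz := is_cderiveV gg0 (is_cderiveM hz (is_cderive_conj hz)).
have hff := is_cderiveM hf (is_cderive_conj hf).
have hss := is_cderiveM hs hs.
apply: is_cderive_eq (is_cderiveM (is_cderive_cst _ _ _)
  (is_cderiveM hss (is_cderiveM hff hzz))) _.
by rewrite mul0r add0r.
Qed.

Lemma Delta_infty_bar_branch q : D q -> Delta_infty_bar n a c L F q = 0.
Proof.
move=> Dq; rewrite /Delta_infty_bar xi1_branch // xi2_branch // /Y1 /Y2.
rewrite (is_cderive_val (is_cderive_xi_density Dq (is_cderive_dg n a c q _)
  (is_cderive_g1 n a b c q) (is_cderive_branch1 Dq))).
rewrite (is_cderive_val (is_cderive_xi_density Dq (is_cderive_dg n a c q _)
  (is_cderive_g2 n a b c q) (is_cderive_branch2 Dq))).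
have gR : g q + conjc (g q) = 2 * ((q.1 - a)%:C * (c * (q.1 - a) ^+ n)%:C).
  rewrite -rmorphM mulrCA -exprS -(Re_g n a b) mulr_natl mulr2n.
  by case: (g q) => x y; apply/eqP; rewrite eq_complex /= subrr addr0 !eqxx.
have sP : (s q)%:C = (c * (q.1 - a) ^+ n)%:C * N%:C.
  by rewrite -rmorphM /dg mulrAC.
have xT : (q.1 - a)%:C * (c * N * (n%:R * (q.1 - a) ^+ n.-1))%:C = n%:R%:C * (s q)%:C.
  rewrite -!rmorphM; congr (_ %:C); rewrite /dg.
  case: (n) => [|m] /=; first by rewrite !mul0r !mulr0.
  by rewrite [_ ^+ m.+1]exprS; ring.
have NAB : N%:C * (al%:C + be%:C) = 1.
  by rewrite -rmorphD exponentsD -rmorphM divff ?pnatr_eq0.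
have NE : N%:C = n%:R%:C + 1 by rewrite -natr1 rmorphD rmorph1.
have := infty_laplacian_algebra (F q) (conjc (F q)) kappa%:C (4 * kappa ^+ 2)%:C
  (g_neq0 Dq) (conj_g_neq0 Dq) (sqr_i R) sP gR xT NAB NE.
rewrite -[dir1.1]/1 -[dir2.1]/0 mulr1 mulr0 => h.
rewrite -[RHS]h /coef1 /coef2.
move: (g q) (F q) (s q) => z f S.
rewrite !conjc_mul !conjc_add !conjc_mul !conjc_opp !conjc_inv conjcK !conjc_real conjc_i.
by rewrite mul0r mulr0 addr0 mul0r add0r.
Qed.

End BranchEquation.

(** * Boundary value and existence of branches *)

Section BranchExistence.
Context {R : realType}.
Variables (n : nat) (a b c L : R).
Hypothesis c_neq0 : c != 0.
Local Notation normc := (@ComplexField.Normc.normc R).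
Local Notation al := ((1 + L) / (2 * n + 2)%N%:R).
Local Notation be := ((1 - L) / (2 * n + 2)%N%:R).
Local Notation g := (g_fun n a b c).
Implicit Types (q p : R * R) (F : R * R -> R[i]) (D : set (R * R)).

Lemma g_center : g (a, b) = 0.
Proof. by apply/eqP; rewrite g_eq0. Qed.

(** All the values at q have the modulus |g q|^(1 / (n + 1)); the power is raised so
that the estimates at (a, b) avoid real exponents. *)
Lemma normc_f_infty F q : f_infty_values n a b c L q (F q) ->
  normc (F q) ^+ n.+1 = normc (g q).
Proof.
move=> /f_infty_values_power/normc_power_values ->; rewrite exponentsD.
by rewrite -powR_mulrn ?powR_ge0 // -powRrM mulVf ?pnatr_eq0 // powRr1 ?normc_ge0.
Qed.

Lemma branch_center F : (forall q, f_infty_values n a b c L q (F q)) -> F (a, b) = 0.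
Proof.
move=> /(_ (a, b))/normc_f_infty/eqP.
by rewrite g_center ComplexField.Normc.normc0 expf_eq0 /= normc_eq0 => /eqP.
Qed.

Lemma ccontinuous_center F : (forall q, f_infty_values n a b c L q (F q)) ->
  ccontinuous_at F (a, b).
Proof.
move=> Fv; have F0 := branch_center Fv.
have near_small e : 0 < e -> \forall p \near (a, b), normc (F p) < e.
  move=> e0.
  have cg := continuous_normc (ccontinuous_g n a b c (a, b)).
  have lt0 : normc (g (a, b)) < e ^+ n.+1.
    by rewrite g_center ComplexField.Normc.normc0 exprn_gt0.
  apply: filterS (cvgr_lt _ cg _ lt0) => p.
  by rewrite -(normc_f_infty (Fv p)) ltr_pXn2r // nnegrE ?normc_ge0 // ltW.
split; apply/cvgrPdist_lt => e e0; apply: filterS (near_small e e0) => p;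
  rewrite F0 /= sub0r normrN; apply: le_lt_trans.
  exact: normr_Re_le.
exact: normr_Im_le.
Qed.

(** The choice th of the argument of g may jump, as long as its effect on the
expression is locally that of a continuous argument. *)
Lemma f_infty_branch_of_arg (D : set (R * R)) (th : R * R -> R) :
  (forall q, is_arg (g q) (th q)) ->
  (forall q, D q -> exists2 t0, slit_plane t0 (g q) &
    \forall p \near q,
      cis ((al - be) * arg_at t0 (g p)) = cis ((al - be) * th p)) ->
  f_infty_branch n a b c L D
    (fun q => (normc (g q) `^ (al + be))%:C * cis ((al - be) * th q)).
Proof.
move=> hth hD; split; first by move=> q; exact: f_infty_values_arg.
move=> q /hD[t0 hs hn].
apply: ccontinuous_near (ccontinuous_power_branch al be (ccontinuous_g n a b c q) hs).
by apply: filterS hn => p; rewrite /power_branch => ->.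
Qed.

Lemma exists_arg_on_slit t0 : exists th : R * R -> R,
  (forall q, is_arg (g q) (th q)) /\
  (forall q, slit_plane t0 (g q) -> th q = arg_at t0 (g q)).
Proof.
have /choice[th hth] : forall q, exists t,
    is_arg (g q) t /\ (slit_plane t0 (g q) -> t = arg_at t0 (g q)).
  move=> q; have [hs|hs] := pselect (slit_plane t0 (g q)).
    by exists (arg_at t0 (g q)); split => //; exact: arg_atP.
  by have [t ht] := exists_arg (g q); exists t.
by exists th; split=> q; have [] := hth q.
Qed.

Lemma exists_branch_on_slit t0 : exists F,
  f_infty_branch n a b c L (g @^-1` slit_plane t0) F.
Proof.
have [th [hth hs]] := exists_arg_on_slit t0; eexists.
apply: (f_infty_branch_of_arg hth) => q /= sq; exists t0 => //.
by apply: filterS (near_slit_plane (ccontinuous_g n a b c q) sq) => p /hs ->.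
Qed.

Lemma open_slit t0 : open (g @^-1` slit_plane t0).
Proof.
by rewrite openE => q /= sq; exact: near_slit_plane (ccontinuous_g n a b c q) sq.
Qed.

Lemma exists_branch_near q : q <> (a, b) -> exists D F,
  [/\ open D, D q, D `<=` [set p | p <> (a, b)] & f_infty_branch n a b c L D F].
Proof.
move=> /eqP; rewrite -(g_eq0 n a b c_neq0) => gq.
have [t0 ht0] := exists_arg (g q); have [F hF] := exists_branch_on_slit t0.
exists (g @^-1` slit_plane t0), F; split => //; first exact: open_slit.
- exact: slit_plane_arg.
- by move=> p /= /slit_plane_neq0; rewrite g_eq0 // => /eqP.
Qed.

(** For n odd, (y1 - a)^(n + 1) >= 0, so g stays in a closed half-plane bounded by
the imaginary axis: the slit opposite to it is never met. *)
Lemma exists_branch_odd : odd n -> exists F,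
  f_infty_branch n a b c L [set q | q <> (a, b)] F.
Proof.
move=> n_odd.
have x_ge0 q : 0 <= (q.1 - a) ^+ n.+1 by rewrite exprn_even_ge0 //= n_odd.
have [t0 ht0] : exists t0, forall q, 0 <= complex.Re (g q * cis (- t0)).
  have [c0|c0] := leP 0 c.
    by exists 0 => q; rewrite oppr0 cis0 mulr1 Re_g mulr_ge0.
  exists pi => q; rewrite cisN cispi.
  rewrite (_ : conjc (-1) = -1); last by rewrite conjc_opp conjc1.
  by rewrite mulrN1 complex_ReN Re_g -mulNr mulr_ge0 // oppr_ge0 ltW.
have [F [Fv Fc]] := exists_branch_on_slit t0; exists F; split=> // q /eqP q0.
have gq0 : 0 < normc (g q) by rewrite normc_gt0 g_eq0.
by apply: Fc; exact: (ltr_pwDl gq0 (ht0 q)).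
Qed.

(** Here alpha - beta = k is an integer, so two arguments of g, which differ by a
multiple of 2 pi, give the same value. *)
Lemma exists_branch_int (k : int) : L = k%:~R * n.+1%:R -> exists F,
  f_infty_branch n a b c L [set q | q <> (a, b)] F.
Proof.
move=> Lk; have ab : al - be = k%:~R.
  by rewrite exponentsB Lk mulfK // pnatr_eq0.
have /choice[th hth] : forall q, exists t, is_arg (g q) t by move=> q; exact: exists_arg.
eexists; apply: (f_infty_branch_of_arg hth) => q /= /eqP.
rewrite -(g_eq0 n a b c_neq0) => gq.
have sq := slit_plane_arg gq (hth q); exists (th q) => //.
apply: filterS (near_slit_plane (ccontinuous_g n a b c q) sq) => p sp.
have [m ->] := is_arg_unique (slit_plane_neq0 sp) (hth p) (arg_atP sp).
rewrite ab -(cis_int (k%:~R * th p) (k * m)) intrM; congr cis; ring.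
Qed.

End BranchExistence.

Theorem theorem6p1 (R : realType) (n : nat) (a b c L : R) (hc : c != 0) :
  [/\ (* every branch, on every open part of the punctured plane *)
      forall (D : set (R * R)) (f : R * R -> R[i]),
        open D -> D `<=` [set q | q <> (a, b)] ->
        f_infty_branch n a b c L D f ->
        smooth_dirichlet_solution n a b c L D f,
      (* branches exist near every point of the punctured plane *)
      forall q : R * R, q <> (a, b) ->
        exists (D : set (R * R)) (f : R * R -> R[i]),
          [/\ open D, D q, D `<=` [set p | p <> (a, b)] &
              f_infty_branch n a b c L D f] &
      (* and on all of it when the expression has no monodromy *)
      (odd n \/ exists k : int, L = k%:~R * n.+1%:R) ->
        exists f : R * R -> R[i],
          f_infty_branch n a b c L [set q | q <> (a, b)] f].
Proof.
split.
- move=> D f Do Dsub fb; split.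
  + exact (smooth_on_branch hc Do Dsub fb).
  + by move=> q Dq; exact (Delta_infty_bar_branch hc Do Dsub fb Dq).
  + exact (branch_center hc fb.1).
  + exact (ccontinuous_center hc fb.1).
- by move=> q; exact: exists_branch_near.
- by case=> [|[k]]; [exact: exists_branch_odd|exact: exists_branch_int].
Qed.
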